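(* Let $m\ge 3$, $n\ge 2$ and $2\le l\le\lceil n/2\rceil$. For every positive integer $k$, $$\chi^b_{B_l(m,n)}(2k)=\Big[\sum_{i=0}^{m-2}(-1)^i(2k-1)^{(m-2)-i}\Big]\,\chi^b_{B_l(m,n-1)}(2k).$$
   Context: A signed graph $(G,\sigma)$ is a finite graph $G$ with a sign function $\sigma:E(G)\to\{+1,-1\}$; its signature is the set of negative edges. A zero-free signed coloring in $2k$ colors is a map $c:V(G)\to\{-k,\dots,-1,1,\dots,k\}$; it is proper if $c(y)\neq\sigma(e)c(x)$ for every edge $e=xy$. The balanced chromatic polynomial $\chi^b_{(G,\sigma)}(2k)$ is the number of proper zero-free signed colorings in $2k$ colors. For integers $m\ge 3$, $n\ge 1$, the Book graph $B(m,n)$ has vertex set $\{u,v\}\cup\{u_j^l:1\le l\le n,\,1\le j\le m-2\}$ and consists of the $n$ cycles $u\,u_1^l\cdots u_{m-2}^l\,v\,u$ sharing the edge $uv$. For $1\le l\le n$, $B_l(m,n)$ denotes $B(m,n)$ with signature $\{uu_1^1,\dots,uu_1^l\}$. *)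

(* Defs.v *)
From HB Require Import structures.
From mathcomp Require Import all_boot all_order all_algebra.

Set Implicit Arguments.
Unset Strict Implicit.
Unset Printing Implicit Defensive.

Import Order.TTheory GRing.Theory Num.Theory.
Local Open Scope ring_scope.

(* Finite graphs; loops and parallel edges are allowed. *)
Record graph := Graph {
  vertex : finType;
  edge : finType;
  ends : edge -> {set vertex};
  ends_card : forall e, (0 < #|ends e| <= 2)%N
}.

Record signed_graph := SignedGraph {
  base :> graph;
  sign : edge base -> int;
  sign_unit : forall e, sign e = 1 \/ sign e = -1
}.

Definition signature (G : signed_graph) : {set edge G} :=
  [set e | sign e == -1].

Definition sign_of (G : graph) (S : {set edge G}) (e : edge G) : int :=
  if e \in S then -1 else 1.

Lemma sign_of_unit (G : graph) (S : {set edge G}) (e : edge G) :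
  sign_of S e = 1 \/ sign_of S e = -1.
Proof. by rewrite /sign_of; case: ifP; [right | left]. Qed.

Definition with_signature (G : graph) (S : {set edge G}) : signed_graph :=
  SignedGraph (sign_of_unit S).

Lemma signature_with_signature (G : graph) (S : {set edge G}) :
  signature (with_signature S) = S.
Proof. by apply/setP => e; rewrite inE /= /sign_of; case: (e \in S). Qed.

(* The colors -1, ..., -k, 1, ..., k, as integers. *)
Definition zero_free_colors (k : nat) : seq int :=
  [seq - i%:Z | i <- iota 1 k] ++ [seq i%:Z | i <- iota 1 k].

Definition color (k : nat) : finType := seq_sub (zero_free_colors k).

Definition color_val (k : nat) (a : color k) : int := ssval a.

Lemma mem_zero_free_colors (k : nat) (x : int) :
  (x \in zero_free_colors k) = (x != 0) && (`|x| <= k%:Z).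
Proof.
rewrite mem_cat; apply/orP/andP => [[] /mapP[i]|[x0 xk]].
- by rewrite mem_iota add1n ltnS => /andP[i0 ik] ->; rewrite normrN; case: i i0 ik.
- by rewrite mem_iota add1n ltnS => /andP[i0 ik] ->; case: i i0 ik.
case: x x0 xk => [i|i] i0 ik; [right | left]; apply/mapP.
  by exists i => //; rewrite mem_iota add1n ltnS lt0n; apply/andP.
by exists i.+1; rewrite ?NegzE // mem_iota add1n ltnS.
Qed.

Lemma card_color (k : nat) : #|color k| = k.*2.
Proof.
rewrite card_seq_sub ?size_cat ?size_map ?size_iota ?addnn //.
rewrite cat_uniq !map_inj_uniq ?iota_uniq ?andbT /=; last first.
- by move=> i j /oppr_inj [].
- by move=> i j [].
apply/hasPn => _ /mapP[i + ->]; rewrite mem_iota => /andP[i0 _].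
apply/mapP => -[j]; rewrite mem_iota => /andP[j0 _].
by case: i i0 => // i _; case: j j0.
Qed.

Definition proper_coloring (G : signed_graph) (k : nat)
    (c : {ffun vertex G -> color k}) : bool :=
  [forall e : edge G, forall x : vertex G, forall y : vertex G,
    (ends e == [set x; y]) ==>
      (color_val (c y) != sign e * color_val (c x))].

(* The value at 2k of the balanced chromatic polynomial. *)
Definition balanced_chromatic (G : signed_graph) (k : nat) : nat :=
  #|[set c : {ffun vertex G -> color k} | proper_coloring c]|.

Section Book.
Variables m n : nat.

(* Pages and positions within a page are numbered from 0: inr (p, j) is the
   vertex u_(j+1)^(p+1). *)
Definition book_vertex : finType := (bool + 'I_n * 'I_(m - 2))%type.
Definition book_u : book_vertex := inl true.
Definition book_v : book_vertex := inl false.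

(* The j-th vertex (0 <= j <= m - 1) of the path u, u_1^p, ..., u_(m-2)^p, v. *)
Definition page_vertex (p : 'I_n) (j : nat) : book_vertex :=
  if j is i.+1 then
    if insub i is Some i' then inr (p, i') else book_v
  else book_u.

(* None is the shared edge uv, and Some (p, j) joins the vertices number j
   and j + 1 of the path of page p. *)
Definition book_edge : finType := option ('I_n * 'I_(m - 1)).

Definition book_ends (e : book_edge) : {set book_vertex} :=
  if e is Some (p, j) then [set page_vertex p j; page_vertex p j.+1]
  else [set book_u; book_v].

Lemma book_ends_card (e : book_edge) : (0 < #|book_ends e| <= 2)%N.
Proof. by case: e => [[p j]|] /=; rewrite cards2; case: (_ == _). Qed.

Definition book : graph := Graph book_ends_card.

(* The edges u u_1^1, ..., u u_1^l. *)
Definition book_signature (l : nat) : {set edge book} :=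
  [set e : book_edge |
    if e is Some (p, j) then (p < l)%N && (j == 0 :> nat) else false].

Definition signed_book (l : nat) : signed_graph :=
  with_signature (book_signature l).

End Book.

(* Main.v *)
Require Import Defs.
From mathcomp Require Import all_boot all_order all_algebra.
From mathcomp Require Import ring zify.
Import Order.TTheory GRing.Theory Num.Theory.
Local Open Scope ring_scope.

(** Since [l < n], the last page carries only positive edges.  A proper coloring
of the book is thus a proper coloring of the book without its last page,
together with a coloring of the [m - 2] inner vertices of a path whose
consecutive vertices get different colors and whose ends have the already
chosen, distinct colors of [u] and [v].  The number of such path colorings is
the number of walks of length [m - 1] between two distinct vertices of the
complete graph on [2k] vertices, which does not depend on these vertices and is
the alternating sum of the theorem. *)

(** A geometric sum: for [q != 0] it equals [((q - 1)^(d + 1) - (-1)^(d + 1)) / q]. *)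
Definition alternating_sum (q : int) (d : nat) : int :=
  \sum_(0 <= i < d.+1) (-1) ^+ i * (q - 1) ^+ (d - i).

Lemma alternating_sumS (q : int) (d : nat) :
  alternating_sum q d.+1 = (q - 1) * alternating_sum q d - (-1) ^+ d.
Proof.
rewrite /alternating_sum big_nat_recr //= subnn mulr1 exprS mulN1r.
congr (_ - _); rewrite mulr_sumr; apply: eq_big_nat => i /andP[_ id].
by rewrite subSn // exprS mulrCA.
Qed.

Definition walk (T : eqType) (a : T) (s : seq T) (b : T) : bool :=
  path [rel x y | x != y] a (rcons s b).

(** Splitting off the first inner vertex [x] leaves a shorter walk from [x] to [b]. *)
Lemma card_walk_rec (T : finType) (d : nat) (a b : T) :
  #|[set t : d.+1.-tuple T | walk T a t b]| =
  (\sum_(x | x != a) #|[set t : d.-tuple T | walk T x t b]|)%N.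
Proof.
pose f (t : d.+1.-tuple T) := (thead t, [tuple of behead t]).
pose g (p : T * d.-tuple T) := [tuple of p.1 :: p.2].
have fK : cancel f g by move=> t; rewrite /f /g /= -tuple_eta.
have gK : cancel g f.
  by case=> x t; rewrite /f /g /= theadE; congr pair; apply: val_inj.
have -> : [set t : d.+1.-tuple T | walk T a t b] =
  f @^-1: [set p : T * d.-tuple T | (p.1 != a) && walk T p.1 p.2 b].
  apply/setP => t; rewrite !inE -{1}(fK t) /walk /=.
  by rewrite [a == _]eq_sym.
rewrite on_card_preimset; last by exists g => x _; [apply: fK | apply: gK].
rewrite -sum1dep_card -(pair_big_dep (fun x => x != a)
  (fun x (t : d.-tuple T) => walk T x t b) (fun _ _ => 1%N)) /=.
by apply: eq_bigr => x _; rewrite sum1dep_card.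
Qed.

(** Closed walks are counted too, since in the induction the first inner vertex may be [b]. Summing
    the correction terms over [x != a] gives [(-1)^d] times [1 - (a == b)], which matches
    [alternating_sumS]. *)
Lemma card_walk (T : finType) (d : nat) (a b : T) :
  #|[set t : d.-tuple T | walk T a t b]|%:Z =
  alternating_sum #|T|%:Z d - (-1) ^+ d * (a == b)%:R.
Proof.
elim: d a => [|d IHd] a.
  rewrite /alternating_sum big_nat1 subnn !expr0 !mul1r.
  case: (eqVneq a b) => [->|ab].
    rewrite subrr -[RHS]/(0%N%:Z); congr Posz; apply/eqP.
    rewrite cards_eq0; apply/eqP/setP => t.
    by rewrite !inE tuple0 /walk /= eqxx.
  rewrite subr0; congr Posz.
  rewrite (_ : [set _ | _] = setT) ?cardsT ?card_tuple //.
  by apply/setP => t; rewrite !inE tuple0 /walk /= ab.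
rewrite card_walk_rec -natz natr_sum.
under eq_bigr => x _ do rewrite natz IHd.
rewrite big_split /= sumr_const cardC1 sumrN -mulr_sumr alternating_sumS.
have -> : \sum_(x | x != a) (x == b)%:R = (a != b)%:R :> int.
  case: (eqVneq a b) => [->|ab]; first by rewrite big1 // => x /negPf->.
  by rewrite (bigD1 b) 1?eq_sym //= eqxx big1 ?addr0 // => x /andP[_ /negPf->].
(* [cardC1] produced the truncated predecessor of [#|T|]; as [T] contains [a], it is a true
   [q - 1]. *)
have /ltn_predK <- : (0 < #|T|)%N by apply/card_gt0P; exists a.
rewrite exprS -[_ *+ _]mulr_natl natz.
by case: (a == b) => /=; rewrite ?mulr0n ?mulr1n; ring.
Qed.

Lemma set2_eqP (T : finType) (x y a b : T) :
  reflect ((a = x /\ b = y) \/ (a = y /\ b = x)) ([set x; y] == [set a; b]).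
Proof.
apply: (iffP eqP) => [/setP E|[[-> ->]|[-> ->]]]; [|by []|by rewrite setUC].
move: (E x) (E y) (E a) (E b); rewrite !inE !eqxx !orbT /=.
move=> /esym /pred2P Hx /esym /pred2P Hy /pred2P Ha /pred2P Hb.
by case: Hx Hy Ha Hb => -> [] -> [] ? [] ?; auto.
Qed.

(** One orientation of an edge suffices: a sign is its own inverse, so the condition is symmetric in
    the two ends. *)
Lemma edge_properE (G : signed_graph) (k : nat) (c : {ffun vertex G -> color k})
    (e : edge G) (a b : vertex G) : ends e = [set a; b] ->
  [forall x, forall y,
    (ends e == [set x; y]) ==> (color_val (c y) != sign e * color_val (c x))] =
  (color_val (c b) != sign e * color_val (c a)).
Proof.
move=> ->; apply/'forall_'forall_implyP/idP => [/(_ a b (eqxx _))//|ab x y].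
case/set2_eqP => -[-> ->] //; apply: contraNneq ab => ->.
by case: (sign_unit e) => ->; rewrite mulrA ?mulrNN !mul1r.
Qed.

Lemma page_vertex_inner (m n : nat) (p : 'I_n) (j : 'I_(m - 2)) :
  page_vertex m p j.+1 = inr (p, j) :> book_vertex m n.
Proof. by rewrite /= insubT // => h; congr (inr (_, _)); apply: val_inj. Qed.

Lemma page_vertex_last (m n : nat) (p : 'I_n) (j : nat) : (m - 2 <= j)%N ->
  page_vertex m p j.+1 = book_v m n.
Proof. by move=> h; rewrite /= insubN // -leqNgt. Qed.

Definition page_proper (m n l k : nat) (c : {ffun book_vertex m n -> color k})
    (p : 'I_n) : bool :=
  [forall j : 'I_(m - 1), color_val (c (page_vertex m p j.+1)) !=
    (-1) ^+ ((p < l)%N && (j == 0 :> nat)) * color_val (c (page_vertex m p j))].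

Lemma proper_bookE (m n l k : nat) (c : {ffun book_vertex m n -> color k}) :
  @proper_coloring (signed_book m n l) k c =
  (c (book_u m n) != c (book_v m n)) && [forall p, page_proper m n l k c p].
Proof.
have signE p j : @sign (signed_book m n l) (Some (p, j)) =
    (-1) ^+ ((p < l)%N && (j == 0 :> nat)).
  by rewrite /= /sign_of inE; case: (_ && _).
have edgeE := edge_properE (signed_book m n l) k c.
rewrite /proper_coloring; apply/forallP/andP => [H|[uv H] [[p j]|]].
- split; last first.
    apply/forallP => p; apply/forallP => j; move: (H (Some (p, j))).
    by rewrite (edgeE _ (page_vertex m p j) (page_vertex m p j.+1)) // signE.
  move: (H None); rewrite (edgeE _ (book_u m n) (book_v m n)) //.
  by rewrite /= /sign_of inE mul1r; apply: contra => /eqP->.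
- rewrite (edgeE _ (page_vertex m p j) (page_vertex m p j.+1)) // signE.
  by move/forallP: H => /(_ p) /forallP /(_ j).
rewrite (edgeE _ (book_u m n) (book_v m n)) //.
by rewrite /= /sign_of inE mul1r eq_sym; apply: contra uv => /eqP /val_inj ->.
Qed.

Definition page_colors (m n k : nat) (c : {ffun book_vertex m n -> color k})
    (p : 'I_n) : (m - 2).-tuple (color k) :=
  [tuple c (inr (p, j)) | j < m - 2].

(** Pages are numbered from 0, so [l <= p] makes all edges of page [p] positive. *)
Lemma page_proper_walk (m n l k : nat) (c : {ffun book_vertex m n -> color k})
    (p : 'I_n) : (3 <= m)%N -> (l <= p)%N ->
  page_proper m n l k c p =
  walk (color k) (c (book_u m n)) (page_colors m n k c p) (c (book_v m n)).
Proof.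
move=> hm lp; rewrite /page_proper ltnNge lp /=.
set t := page_colors m n k c p.
have nth_page j : (j < m - 1)%N ->
    nth (c (book_v m n)) (rcons t (c (book_v m n))) j =
      c (page_vertex m p j.+1).
  move=> jm; rewrite nth_rcons size_tuple; case: ltnP => [h|h].
    rewrite -[j]/(val (Ordinal h)) page_vertex_inner.
    by rewrite -tnth_nth tnth_mktuple.
  (* The default of [nth] is the color of [v], so both remaining branches of [nth_rcons] agree. *)
  by rewrite page_vertex_last // if_same.
have sz : size (rcons t (c (book_v m n))) = (m - 1)%N.
  by rewrite size_rcons size_tuple; lia.
apply/forallP/(pathP (c (book_v m n))) => [H i|H i].
  rewrite sz => im /=; move: (H (Ordinal im)); rewrite mul1r nth_page //.
  case: i im => [|i] im /=; apply: contra => /eqP E.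
    by rewrite -E.
  by rewrite -E nth_page // ltnW.
have im := ltn_ord i; move: (H i); rewrite sz mul1r => /(_ im) /=.
rewrite nth_page // eq_sym; apply: contra => /eqP /val_inj ->.
by case: (val i) im => [|j] jm //=; rewrite nth_page // ltnW.
Qed.

Definition drop_last_page (m n k : nat)
    (c : {ffun book_vertex m n.+1 -> color k}) :
    {ffun book_vertex m n -> color k} :=
  [ffun x => match x with
    | inl b => c (inl b)
    | inr (p, j) => c (inr (lift ord_max p, j))
    end].

Definition add_page (m n k : nat) (c : {ffun book_vertex m n -> color k})
    (t : (m - 2).-tuple (color k)) : {ffun book_vertex m n.+1 -> color k} :=
  [ffun x => match x with
    | inl b => c (inl b)
    | inr (p, j) =>
        if unlift ord_max p is Some p' then c (inr (p', j)) else tnth t j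
    end].

(** [lift ord_max] keeps the number of a page, hence also the signs of its edges. *)
Lemma page_proper_drop_last (m n l k : nat)
    (c : {ffun book_vertex m n.+1 -> color k}) (p : 'I_n) :
  page_proper m n l k (drop_last_page m n k c) p =
  page_proper m n.+1 l k c (lift ord_max p).
Proof.
have dropE j :
    drop_last_page m n k c (page_vertex m p j) =
      c (page_vertex m (lift ord_max p) j).
  by rewrite ffunE; case: j => [|j] //=; case: insub.
by rewrite /page_proper; apply: eq_forallb => j; rewrite !dropE lift_max.
Qed.

Lemma proper_book_last_page (m n l k : nat)
    (c : {ffun book_vertex m n.+1 -> color k}) : (3 <= m)%N -> (l <= n)%N ->
  @proper_coloring (signed_book m n.+1 l) k c =
  @proper_coloring (signed_book m n l) k (drop_last_page m n k c) &&
  walk (color k) (c (book_u m n.+1)) (page_colors m n.+1 k c ord_max)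
    (c (book_v m n.+1)).
Proof.
move=> hm ln; rewrite !proper_bookE !ffunE -andbA; congr (_ && _).
rewrite -(page_proper_walk m n.+1 l) //.
apply/forallP/andP => [H|[/forallP H Hmax] p].
  by split=> //; apply/forallP => p; rewrite page_proper_drop_last.
by case: (unliftP ord_max p) => [p'|] ->; rewrite -?page_proper_drop_last.
Qed.

(** Colorings of the larger book correspond bijectively to pairs of a coloring of the smaller book
    and a tuple of colors for the last page. *)
Lemma balanced_chromatic_book_rec (m n l k : nat) :
    (3 <= m)%N -> (l <= n)%N ->
  (balanced_chromatic (signed_book m n.+1 l) k)%:Z =
  alternating_sum (2 * k)%:Z (m - 2) *
  (balanced_chromatic (signed_book m n l) k)%:Z.
Proof.
move=> hm ln; rewrite /balanced_chromatic.
pose f (c : {ffun book_vertex m n.+1 -> color k}) :=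
  (drop_last_page m n k c, page_colors m n.+1 k c ord_max).
pose g p := add_page m n k p.1 p.2.
have fK : cancel f g.
  move=> c; apply/ffunP => -[b|[p j]]; rewrite !ffunE //.
  by case: (unliftP ord_max p) => [p'|] ->; rewrite ?ffunE ?tnth_mktuple.
have gK : cancel g f.
  move=> [c t]; congr pair.
    by apply/ffunP => -[b|[p j]]; rewrite !ffunE // liftK.
  by apply: eq_from_tnth => j; rewrite tnth_mktuple ffunE unlift_none.
pose ok (c : {ffun book_vertex m n -> color k})
    (t : (m - 2).-tuple (color k)) :=
  walk (color k) (c (book_u m n)) t (c (book_v m n)).
have -> : [set c | @proper_coloring (signed_book m n.+1 l) k c] =
    f @^-1: [set p | @proper_coloring (signed_book m n l) k p.1 && ok p.1 p.2].
  by apply/setP => c; rewrite !inE proper_book_last_page // /ok !ffunE.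
rewrite on_card_preimset; last by exists g => x _; [apply: fK | apply: gK].
rewrite -sum1dep_card -(pair_big_dep
  (fun c => @proper_coloring (signed_book m n l) k c) ok (fun _ _ => 1%N)) /=.
rewrite -natz natr_sum -sum1dep_card -[X in _ * X]natz natr_sum mulr_sumr.
(* The positive edge [uv] gives [u] and [v] distinct colors, so the correction term of [card_walk]
   vanishes and each [c] has the same number of extensions. *)
apply: eq_bigr => c; rewrite proper_bookE => /andP[/negPf uv _].
by rewrite sum1dep_card natz card_walk uv mulr0 subr0 mulr1 card_color mul2n.
Qed.

Theorem theorem7p8 (m n l k : nat)
    (hm : (3 <= m)%N) (hn : (2 <= n)%N)
    (hl : (2 <= l)%N /\ (l <= uphalf n)%N) (hk : (0 < k)%N) :
  (balanced_chromatic (signed_book m n l) k)%:Z =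
    (\sum_(0 <= i < (m - 2).+1) (-1) ^+ i * ((2 * k)%:Z - 1) ^+ ((m - 2) - i))
    * (balanced_chromatic (signed_book m (n - 1) l) k)%:Z.
Proof.
case: n hn hl => // n _ [l2 ln]; rewrite subn1.
(* Here [n] is one less than the number of pages: [uphalf n.+1] is [n./2 + 1], so [2 <= l] forces
   [2 <= n], whence [l <= n]. *)
by apply: balanced_chromatic_book_rec => //; lia.
Qed.
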